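(* Let $\mathrm{SPD}(n)$ carry the Bures-Wasserstein metric. Let $\Sigma,\Lambda\in\mathrm{SPD}(n)$, let $\gamma(t)$ be the geodesic with $\gamma(0)=\Sigma$ and $\gamma(1)=\Lambda$, and let $X\in T_\Sigma\mathrm{SPD}(n)$. Denote by $\gamma^h(t)=(1-t)\Sigma^{1/2}+t\Sigma^{-1/2}(\Sigma^{1/2}\Lambda\Sigma^{1/2})^{1/2}$ the horizontal lift of $\gamma$ and by $\dot\gamma^h$ its (constant) derivative. Let $X(t)$ be a vector field along $\gamma(t)$ with $X(0)=X$. The following two statements are equivalent: (i) The vector field $X(t)$ defined along $\gamma(t)$ is the parallel transport of $X$. (ii) $X(t)=\gamma(t)X^0(t)+X^0(t)\gamma(t)$ where $X^0(t)$ is a curve in $\mathrm{Sym}(n)$ satisfying the ODE $$\gamma(t)\dot X^0(t)+\dot X^0(t)\gamma(t)+\gamma^h(t)\,\dot\gamma^{h\top}X^0(t)+X^0(t)\,\dot\gamma^h\,\gamma^h(t)^\top=0 .$$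
   Context: $\mathrm{SPD}(n)$ is the manifold of real symmetric positive definite $n\times n$ matrices, an open subset of the space $\mathrm{Sym}(n)$ of symmetric matrices; tangent spaces are identified with $\mathrm{Sym}(n)$. The Bures-Wasserstein metric is $g_\Sigma(X,X)=\frac12\sum_{i,j}\frac{1}{d_i+d_j}X_{ij}'^2$ where $\Sigma=PDP^\top$ with $P\in\mathrm{O}(n)$, $D=\mathrm{Diag}(d_1,\dots,d_n)$ and $X'=P^\top XP$. It is the quotient metric of the Frobenius metric $G_A(M,M)=\mathrm{tr}(MM^\top)$ on $\mathrm{GL}(n)$ by the submersion $\pi(A)=AA^\top$, and $\gamma(t)=\gamma^h(t)\gamma^h(t)^\top$. Parallel transport is with respect to the Levi-Civita connection of the Bures-Wasserstein metric. *)

(* Defs.v *)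
From HB Require Import structures.
From mathcomp Require Import all_boot all_order all_algebra.
From mathcomp Require Import all_classical all_reals all_analysis.

Set Implicit Arguments.
Unset Strict Implicit.
Unset Printing Implicit Defensive.

Import Order.TTheory GRing.Theory Num.Theory.
Import numFieldNormedType.Exports.

Local Open Scope classical_set_scope.
Local Open Scope ring_scope.

Definition spd (R : realType) (n : nat) (A : 'M[R]_n) : Prop :=
  A \is symmetricmx /\
  forall v : 'cV[R]_n, v != 0 -> 0 < (v^T *m A *m v) 0 0.

Definition spd_sqrt (R : realType) (n : nat) (A : 'M[R]_n) : 'M[R]_n :=
  xget 0 [set S | spd S /\ S *m S = A].

Definition spectral_decomposition (R : realType) (n : nat) (A : 'M[R]_n)
    (Pd : 'M[R]_n * 'rV[R]_n) : Prop :=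
  Pd.1^T *m Pd.1 = 1%:M /\ A = Pd.1 *m diag_mx Pd.2 *m Pd.1^T.

(* The symmetric bilinear form polarizing
   g_S(X, X) = 1/2 \sum_(i, j) X'_ij ^ 2 / (d_i + d_j),
   where S = P diag(d) P^T and X' = P^T X P. For S in SPD(n) the value does not
   depend on which decomposition is selected. *)
Definition bw_metric (R : realType) (n : nat) (S X Y : 'M[R]_n) : R :=
  let Pd := xget (1%:M, 0) (spectral_decomposition S) in
  let P := Pd.1 in
  let d := Pd.2 in
  let X' := P^T *m X *m P in
  let Y' := P^T *m Y *m P in
  2^-1 * \sum_i \sum_j (d 0 i + d 0 j)^-1 * (X' i j * Y' i j).

(* SPD(n) is open in the vector space Sym(n), so vector fields on it are
   Sym(n)-valued functions; only the values at points of SPD(n), and derivatives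
   in symmetric directions, are relevant. *)
Definition vector_field (R : realType) (n : nat)
    (X : 'M[R]_n -> 'M[R]_n) : Prop :=
  forall S : 'M[R]_n, spd S ->
    X S \is symmetricmx /\
    forall V : 'M[R]_n, V \is symmetricmx -> derivable X S V.

Definition lie_bracket (R : realType) (n : nat)
    (X Y : 'M[R]_n -> 'M[R]_n) (S : 'M[R]_n) : 'M[R]_n :=
  'D_(X S) Y S - 'D_(Y S) X S.

(* In the global chart Sym(n), every affine connection on SPD(n) is the flat
   derivative plus a field Gamma of bilinear maps Sym(n) x Sym(n) -> Sym(n), its
   Christoffel symbols. *)
Definition christoffel (R : realType) (n : nat)
    (Gamma : 'M[R]_n -> 'M[R]_n -> 'M[R]_n -> 'M[R]_n) : Prop :=
  forall S : 'M[R]_n, spd S ->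
  forall (c : R) (X Y Z : 'M[R]_n), X \is symmetricmx -> Y \is symmetricmx ->
    Z \is symmetricmx ->
    [/\ Gamma S X Y \is symmetricmx,
        Gamma S (c *: X + Y) Z = c *: Gamma S X Z + Gamma S Y Z
      & Gamma S Z (c *: X + Y) = c *: Gamma S Z X + Gamma S Z Y].

Definition nabla (R : realType) (n : nat)
    (Gamma : 'M[R]_n -> 'M[R]_n -> 'M[R]_n -> 'M[R]_n)
    (X Y : 'M[R]_n -> 'M[R]_n) (S : 'M[R]_n) : 'M[R]_n :=
  'D_(X S) Y S + Gamma S (X S) (Y S).

Definition torsion_free (R : realType) (n : nat)
    (Gamma : 'M[R]_n -> 'M[R]_n -> 'M[R]_n -> 'M[R]_n) : Prop :=
  forall X Y : 'M[R]_n -> 'M[R]_n, vector_field X -> vector_field Y ->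
  forall S : 'M[R]_n, spd S ->
    nabla Gamma X Y S - nabla Gamma Y X S = lie_bracket X Y S.

Definition metric_compatible (R : realType) (n : nat)
    (g : 'M[R]_n -> 'M[R]_n -> 'M[R]_n -> R)
    (Gamma : 'M[R]_n -> 'M[R]_n -> 'M[R]_n -> 'M[R]_n) : Prop :=
  forall X Y Z : 'M[R]_n -> 'M[R]_n,
  vector_field X -> vector_field Y -> vector_field Z ->
  forall S : 'M[R]_n, spd S ->
    is_derive S (Z S) (fun T : 'M[R]_n => g T (X T) (Y T))
      (g S (nabla Gamma Z X S) (Y S) + g S (X S) (nabla Gamma Z Y S)).

(* Smoothness of Gamma is not required: for a smooth metric g it follows from
   Koszul's formula, which also determines Gamma on SPD(n) x Sym(n) x Sym(n). *)
Definition levi_civita (R : realType) (n : nat)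
    (g : 'M[R]_n -> 'M[R]_n -> 'M[R]_n -> R)
    (Gamma : 'M[R]_n -> 'M[R]_n -> 'M[R]_n -> 'M[R]_n) : Prop :=
  [/\ christoffel Gamma, torsion_free Gamma & metric_compatible g Gamma].

(* Curves are functions on R of which only the restriction to the open interval
   J matters. *)
Definition field_along (R : realType) (n : nat) (J : set R)
    (X : R -> 'M[R]_n) : Prop :=
  forall t : R, J t -> X t \is symmetricmx.

Definition cov_derive (R : realType) (n : nat)
    (Gamma : 'M[R]_n -> 'M[R]_n -> 'M[R]_n -> 'M[R]_n)
    (gamma X : R -> 'M[R]_n) (t : R) : 'M[R]_n :=
  derive1 X t + Gamma (gamma t) (derive1 gamma t) (X t).

Definition parallel_along (R : realType) (n : nat)
    (Gamma : 'M[R]_n -> 'M[R]_n -> 'M[R]_n -> 'M[R]_n) (J : set R)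
    (gamma X : R -> 'M[R]_n) : Prop :=
  field_along J X /\
  forall t : R, J t -> derivable X t 1 /\ cov_derive Gamma gamma X t = 0.

Definition parallel_transport (R : realType) (n : nat)
    (Gamma : 'M[R]_n -> 'M[R]_n -> 'M[R]_n -> 'M[R]_n) (J : set R)
    (gamma : R -> 'M[R]_n) (x : 'M[R]_n) (X : R -> 'M[R]_n) : Prop :=
  X 0 = x /\ parallel_along Gamma J gamma X.

Definition geodesic (R : realType) (n : nat)
    (Gamma : 'M[R]_n -> 'M[R]_n -> 'M[R]_n -> 'M[R]_n) (J : set R)
    (gamma : R -> 'M[R]_n) : Prop :=
  (forall t : R, J t -> spd (gamma t) /\ derivable gamma t 1) /\
  parallel_along Gamma J gamma (derive1 gamma).

Definition bw_horizontal_lift (R : realType) (n : nat) (S L : 'M[R]_n) (t : R)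
    : 'M[R]_n :=
  let S12 := spd_sqrt S in
  (1 - t) *: S12 + t *: (invmx S12 *m spd_sqrt (S12 *m L *m S12)).

(* Main.v *)
(* Let L_T(X) denote the solution Y of T Y + Y T = X. The Bures-Wasserstein metric
   is g_T(X, Y) = 1/2 tr(X L_T(Y)), and Koszul's argument on constant fields gives
     Gamma_T(X, Y) = - (L_T(X) T L_T(Y) + L_T(Y) T L_T(X)).
   Along a geodesic, Y = L_gamma(gamma') therefore solves the Riccati equation
   Y' = - Y^2. With S = Y(0), two first integrals yield Y (1 + t S) = S and
   gamma = (1 + t S) Sigma (1 + t S); as 1 + t S stays invertible on [0, 1],
   1 + S is positive definite, so that it is the optimal transport map from Sigma
   to Lambda and gammah(t) = (1 + t S) Sigma^(1/2). Hence
   gammah gammah'^T = gamma Y, and differentiating X = gamma X^0 + X^0 gamma turns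
   the equation of parallel transport into the stated one. *)
Require Import Defs.
From HB Require Import structures.
From mathcomp Require Import all_boot all_order all_algebra.
From mathcomp Require Import perm complex ring lra.
From mathcomp Require Import all_classical all_reals all_analysis.

Set Implicit Arguments.
Unset Strict Implicit.
Unset Printing Implicit Defensive.

Import Order.TTheory GRing.Theory Num.Theory.
Import numFieldNormedType.Exports.

Local Open Scope classical_set_scope.
Local Open Scope ring_scope.

(** * Spectral theorem for real symmetric matrices *)

Lemma symmetricmxP (R : fieldType) (n : nat) (A : 'M[R]_n) :
  A \is symmetricmx <-> A^T = A.
Proof.
have E : (-1) ^+ false *: map_mx idfun A^T = A^T.
  by rewrite expr0 scale1r map_mx_id.
by split=> [/is_hermitianmxP|AT]; [rewrite E|apply/is_hermitianmxP; rewrite E].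
Qed.

Lemma row_dot_ge0 (R : realDomainType) (n : nat) (u : 'rV[R]_n) :
  0 <= (u *m u^T) 0 0.
Proof. by rewrite mxE sumr_ge0// => i _; rewrite mxE -expr2 sqr_ge0. Qed.

Lemma row_dot_eq0 (R : realDomainType) (n : nat) (u : 'rV[R]_n) :
  (u *m u^T) 0 0 = 0 -> u = 0.
Proof.
rewrite mxE => /eqP; rewrite psumr_eq0; last first.
  by move=> i _; rewrite mxE -expr2 sqr_ge0.
move=> /allP u0; apply/rowP => i; have := u0 i (mem_index_enum i).
by rewrite !mxE -expr2 sqrf_eq0 => /eqP.
Qed.

(** Over the complex numbers [A] is Hermitian, hence unitarily diagonalizable with real spectrum. A
    diagonal entry is then a real root of the characteristic polynomial, and a vanishing real
    determinant gives a real row eigenvector. *)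
Lemma symmetric_eigenvector (R : rcfType) (n : nat) (A : 'M[R]_n) :
  (0 < n)%N -> A^T = A -> exists a, exists2 v : 'rV_n, v != 0 & v *m A = a *: v.
Proof.
move=> n0 AT; pose iota := real_complex R : {rmorphism R -> R[i]}.
pose Ac := map_mx iota A.
have Ah : Ac \is hermsymmx.
  apply: realsym_hermsym; first by apply/symmetricmxP; rewrite map_trmx AT.
  by apply/mxOverP => i j; rewrite mxE complex_real.
have /hermitian_normalmx /orthomx_spectralP A_eq := Ah.
have /mxOverP dR := hermitian_spectral_diag_real Ah.
have Pu := spectral_unit Ac.
move: (spectralmx _) (spectral_diag _) A_eq dR Pu => P d A_eq dR Pu.
have [a da] : exists a, d 0 (Ordinal n0) = iota a.
  exists (complex.Re (d 0 (Ordinal n0))).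
  by apply/esym/RRe_real; exact: dR.
have : \det (A - a%:M) = 0.
  apply: (fmorph_inj iota); rewrite rmorph0 -det_map_mx map_mxB map_scalar_mx.
  rewrite -/Ac A_eq -da.
  have -> : (d 0 (Ordinal n0))%:M = invmx P *m (d 0 (Ordinal n0))%:M *m P.
    by rewrite mul_mx_scalar -scalemxAl mulVmx// scalemx1.
  rewrite -mulmxBl -mulmxBr !det_mulmx.
  suff -> : \det (diag_mx d - (d 0 (Ordinal n0))%:M) = 0 by rewrite mulr0 mul0r.
  rewrite -diag_const_mx -linearB/= det_diag; apply/eqP/prodf_eq0.
  by exists (Ordinal n0) => //; rewrite !mxE subrr.
move=> /eqP/det0P[v v0 vA]; exists a; exists v => //.
by apply/eqP; rewrite -mul_mx_scalar -subr_eq0 -mulmxBr vA.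
Qed.

(** The reflection in the hyperplane orthogonal to [u - e] exchanges the unit vectors [e] and [u];
    it serves to complete an eigenvector to an orthogonal matrix. *)
Lemma householder (R : realFieldType) (n : nat) (u : 'rV[R]_n.+1) :
  (u *m u^T) 0 0 = 1 ->
  exists H : 'M[R]_n.+1, [/\ H^T = H, H *m H = 1%:M & row 0 H = u].
Proof.
move=> u1; pose e : 'rV[R]_n.+1 := delta_mx 0 0.
have [w wE] : {w | w = u - e} by exists (u - e).
have [w0|w0] := eqVneq w 0.
  exists 1%:M; rewrite trmx1 mulmx1 row1; split=> //.
  by apply/esym/eqP; rewrite -subr_eq0 -/e -wE w0.
have c0 : (w *m w^T) 0 0 != 0 by apply: contra_neq w0 => /row_dot_eq0.
set c := (w *m w^T) 0 0 in c0.
have wwT : w *m w^T = c%:M by rewrite [LHS]mx11_scalar.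
pose H := 1%:M - (2 / c) *: (w^T *m w).
exists H; split.
- by rewrite /H linearB/= trmx1 linearZ/= trmx_mul trmxK.
- have WW : w^T *m w *m (w^T *m w) = c *: (w^T *m w).
    by rewrite -mulmxA (mulmxA w w^T) wwT mul_scalar_mx -scalemxAr.
  rewrite /H mulmxBl mul1mx mulmxBr mulmx1 -scalemxAl -scalemxAr WW !scalerA.
  have -> : 2 / c * (2 / c) * c = 2 / c + 2 / c by field.
  rewrite scalerDl; apply/eqP; rewrite -subr_eq0; apply/eqP/matrixP => i j.
  by rewrite !mxE; ring.
- rewrite rowE mulmxBr mulmx1 -scalemxAr mulmxA -/e.
  (* As [u] and [e] are unit vectors, [c = 2 - 2 * u 0 0], so the inner product of [e] and [w] is
     [- c / 2] and the reflection sends [e] to [e + w = u]. *)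
  have -> : e *m w^T = (- (c / 2))%:M.
    rewrite [LHS]mx11_scalar; congr (_%:M).
    have eE (v : 'rV[R]_n.+1) : (e *m v^T) 0 0 = v 0 0 by rewrite -rowE !mxE.
    have uE (v : 'rV[R]_n.+1) : (v *m e^T) 0 0 = v 0 0.
      by rewrite -[v *m _]trmxK trmx_mul trmxK mxE eE.
    have -> : c = 2 - 2 * u 0 0.
      rewrite /c wE linearB/= mulmxBl !mulmxBr.
      have subE (X Y : 'M[R]_1) : (X - Y) 0 0 = X 0 0 - Y 0 0 by rewrite !mxE.
      by rewrite !subE u1 !eE uE mxE !eqxx mulr1n; ring.
    by rewrite eE wE !mxE eqxx mulr1n; field.
  rewrite mul_scalar_mx scalerA.
  have -> : 2 / c * - (c / 2) = -1 by field.
  by rewrite scaleN1r opprK wE addrC subrK.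
Qed.

(** Deflation: a reflection [H] whose first row is a unit eigenvector makes the first row of [H A H]
    a multiple of the first basis vector. By symmetry [H A H] is block diagonal, and the induction
    hypothesis handles the lower block. *)
Lemma spectral_theorem (R : realType) (n : nat) (A : 'M[R]_n) :
  A^T = A -> exists Pd, spectral_decomposition A Pd.
Proof.
elim: n A => [|n IH] A AT.
  exists (1%:M, 0); split => /=; first by rewrite mulmx1 trmx1.
  by apply/matrixP => -[].
have [a [v v0 vA]] := symmetric_eigenvector (ltn0Sn n) AT.
pose s := Num.sqrt ((v *m v^T) 0 0).
have s2 : s ^+ 2 = (v *m v^T) 0 0 by rewrite sqr_sqrtr ?row_dot_ge0.
have s0 : s != 0.
  apply: contra_neq v0 => s0; apply: row_dot_eq0.
  by rewrite -s2 s0 expr0n.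
have [|H [HT HH Hu]] := @householder R n (s^-1 *: v).
  rewrite linearZ/= -scalemxAl -scalemxAr scalerA mxE -s2.
  by field.
have uA : row 0 H *m A = a *: row 0 H.
  by rewrite Hu -scalemxAl vA !scalerA mulrC.
have [B defB] : {B : 'M[R]_(1 + n) | B = H *m A *m H} by exists (H *m A *m H).
have BT : B^T = B by rewrite defB !trmx_mul HT AT mulmxA.
have BE : B = block_mx a%:M 0 0 (drsubmx B).
  have e0B : row 0 B = a *: delta_mx 0 0.
    by rewrite defB !row_mul uA -scalemxAl -row_mul HH row1.
  have ur0 : ursubmx B = 0.
    apply/matrixP => i j; rewrite !mxE.
    move/rowP : e0B => /(_ (rshift 1 j)); rewrite !mxE/= mulr0 => <-.
    by congr (B _ _); apply/val_inj; rewrite /= ord1.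
  rewrite -[LHS]submxK ur0; congr block_mx.
    apply/matrixP => i j; rewrite !ord1 !mxE/=.
    move/rowP : e0B => /(_ 0); rewrite !mxE eqxx mulr1 mulr1n => <-.
    by congr (B _ _); apply/val_inj.
  by rewrite -BT -trmx_ursub ur0 trmx0.
have [|[P d] [/= PP BPd]] := IH (drsubmx B).
  by rewrite trmx_drsub BT.
pose K : 'M[R]_(1 + n) := block_mx 1%:M 0 0 P.
pose D : 'rV[R]_(1 + n) := row_mx a%:M d.
have KK : K^T *m K = 1%:M.
  rewrite /K tr_block_mx mulmx_block.
  rewrite !(trmx0, trmx1, mul0mx, mulmx0, mulmx1, addr0, add0r) PP.
  by rewrite -scalar_mx_block.
have BKD : B = K *m diag_mx D *m K^T.
  rewrite {1}BE /D diag_mx_row /K tr_block_mx.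
  have -> : diag_mx (a%:M : 'rV_1) = a%:M.
    by apply/matrixP => i j; rewrite !ord1 !mxE.
  rewrite !mulmx_block.
  rewrite !(trmx0, trmx1, mul0mx, mulmx0, mul1mx, mulmx1, addr0, add0r).
  by rewrite -BPd.
exists (H *m K, D); split => /=.
  by rewrite trmx_mul HT mulmxA -(mulmxA _ H H) HH mulmx1.
have <- : H *m B *m H = A by rewrite defB !mulmxA HH mul1mx -mulmxA HH mulmx1.
by rewrite BKD trmx_mul HT !mulmxA.
Qed.

(** * Positive definite matrices and their square roots *)

Lemma spd_tr (R : realType) (n : nat) (A : 'M[R]_n) : spd A -> A^T = A.
Proof. by case=> /symmetricmxP. Qed.

(** Lets definiteness be tested on a whole matrix [Y], column by column, through a trace. *)
Lemma mxtrace_quad (R : realType) (m n : nat) (A : 'M[R]_n) (Y : 'M[R]_(n, m)) :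
  \tr (Y^T *m A *m Y) = \sum_i ((col i Y)^T *m A *m col i Y) 0 0.
Proof.
apply: eq_bigr => i _.
have -> : (col i Y)^T *m A *m col i Y
        = delta_mx 0 i *m (Y^T *m A *m Y *m delta_mx i 0).
  by rewrite colE trmx_mul trmx_delta !mulmxA.
by rewrite -rowE -colE !mxE.
Qed.

Lemma spd_trace_ge0 (R : realType) (m n : nat) (A : 'M[R]_n) (Y : 'M[R]_(n, m)) :
  spd A -> 0 <= \tr (Y^T *m A *m Y).
Proof.
move=> [_ A0]; rewrite mxtrace_quad sumr_ge0// => i _.
have [->|/A0/ltW//] := eqVneq (col i Y) 0.
by rewrite mulmx0 mxE.
Qed.

Lemma spd_trace_eq0 (R : realType) (m n : nat) (A : 'M[R]_n) (Y : 'M[R]_(n, m)) :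
  spd A -> \tr (Y^T *m A *m Y) = 0 -> Y = 0.
Proof.
move=> [_ A0]; rewrite mxtrace_quad => /eqP; rewrite psumr_eq0; last first.
  move=> i _; have [->|/A0/ltW//] := eqVneq (col i Y) 0.
  by rewrite mulmx0 mxE.
move=> /allP Y0; apply/matrixP => i j.
have [/matrixP/(_ i 0)|/A0] := eqVneq (col j Y) 0; first by rewrite !mxE.
by have /= /eqP -> := Y0 j (mem_index_enum j); rewrite ltxx.
Qed.

Lemma spd_unitmx (R : realType) (n : nat) (A : 'M[R]_n) : spd A -> A \in unitmx.
Proof.
move=> A0; rewrite unitmxE unitfE; apply/negP => /det0P[v v0 vA].
move/negP : v0; apply; rewrite -[v]trmxK -trmx0 (inj_eq trmx_inj); apply/eqP.
by apply: (spd_trace_eq0 A0); rewrite trmxK vA mul0mx mxtrace0.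
Qed.

Lemma spd_congr (R : realType) (n : nat) (A B : 'M[R]_n) :
  spd A -> B \in unitmx -> spd (B^T *m A *m B).
Proof.
move=> A0 Bu; split.
  by apply/symmetricmxP; rewrite !trmx_mul trmxK (spd_tr A0) mulmxA.
move=> v v0.
have -> : v^T *m (B^T *m A *m B) *m v = (B *m v)^T *m A *m (B *m v).
  by rewrite trmx_mul !mulmxA.
apply: A0.2; apply: contra_neq v0 => Bv.
by rewrite -[v](mulKmx Bu) Bv mulmx0.
Qed.

(** Multiplying by [Y^T] and taking traces writes 0 as the sum of the nonnegative traces of
    [Y^T A Y] and [Y B Y^T]. This gives uniqueness for square roots, for the Lyapunov equation and
    in the derivation of the Riccati equation. *)
Lemma sylvester2_eq0 (R : realType) (n : nat) (A B Y : 'M[R]_n) :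
  spd A -> spd B -> A *m Y + Y *m B = 0 -> Y = 0.
Proof.
move=> A0 B0 AYB; apply: (spd_trace_eq0 A0); apply: le_anti.
rewrite spd_trace_ge0// andbT.
have -> : \tr (Y^T *m A *m Y) = - \tr (Y^T^T *m B *m Y^T).
  apply/eqP; rewrite -addr_eq0 trmxK mxtrace_mulC [X in _ + X]mxtrace_mulC.
  rewrite [X in X + _]mxtrace_mulC -mulmxA -mxtraceD -mulmxDr AYB.
  by rewrite mulmx0 mxtrace0.
by rewrite oppr_le0 spd_trace_ge0.
Qed.

Lemma spd_diag (R : realType) (n : nat) (A : 'M[R]_n) P d :
  spectral_decomposition A (P, d) -> (forall i, 0 < d 0 i) -> spd A.
Proof.
move=> [/= PP ->] d0.
have PTu : P^T \in unitmx by have [] := mulmx1_unit PP.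
rewrite -{1}[P]trmxK; apply: spd_congr => //; split.
  by apply/symmetricmxP; rewrite tr_diag_mx.
move=> v v0.
have E : (v^T *m diag_mx d *m v) 0 0 = \sum_i d 0 i * v i 0 ^+ 2.
  rewrite mxE; apply: eq_bigr => i _.
  by rewrite mul_mx_diag !mxE mulrAC -expr2 mulrC.
rewrite E lt_def sumr_ge0 ?andbT; last first.
  by move=> i _; rewrite mulr_ge0 ?sqr_ge0 ?ltW.
rewrite psumr_eq0; last by move=> i _; rewrite mulr_ge0 ?sqr_ge0 ?ltW.
apply: contra_neqN v0 => /allP v0; apply/colP => i.
have := v0 i (mem_index_enum i); rewrite /= mulf_eq0 sqrf_eq0 mxE.
by rewrite (gt_eqF (d0 i)) => /eqP.
Qed.

Lemma spd_spectral (R : realType) (n : nat) (A : 'M[R]_n) P d :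
  spd A -> spectral_decomposition A (P, d) -> forall i, 0 < d 0 i.
Proof.
move=> A0 [/= PP AE] i.
have v0 : P *m delta_mx i 0 != 0 :> 'cV_n.
  apply/negP => /eqP/(congr1 (mulmx P^T)).
  rewrite mulmxA PP mul1mx mulmx0 => /colP/(_ i); rewrite !mxE !eqxx => /eqP.
  by rewrite oner_eq0.
have := A0.2 _ v0; rewrite AE trmx_mul !mulmxA -(mulmxA _ P^T P) PP mulmx1.
rewrite -!mulmxA (mulmxA P^T P) PP mul1mx -colE trmx_delta -rowE !mxE eqxx.
by rewrite mulr1n.
Qed.

(** Since [S (S - T) + (S - T) T] equals [S S - T T], the difference solves a homogeneous Sylvester
    equation. *)
Lemma spd_sqrt_unique (R : realType) (n : nat) (S T : 'M[R]_n) :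
  spd S -> spd T -> S *m S = T *m T -> S = T.
Proof.
move=> S0 T0 ST; apply/eqP; rewrite -subr_eq0; apply/eqP.
apply: (sylvester2_eq0 S0 T0).
by rewrite mulmxBr mulmxBl ST addrA subrK subrr.
Qed.

Lemma spd_sqrtP (R : realType) (n : nat) (A : 'M[R]_n) :
  spd A -> spd (spd_sqrt A) /\ spd_sqrt A *m spd_sqrt A = A.
Proof.
move=> A0; rewrite /spd_sqrt; case: xgetP => [S _ //|noS].
have [[P d] Pd] := spectral_theorem (spd_tr A0).
have d0 := spd_spectral A0 Pd; have [/= PP AE] := Pd.
(* A root built from the spectral decomposition rules out the default value of [xget]. *)
pose e := map_mx Num.sqrt d; pose S := P *m diag_mx e *m P^T.
case: (noS S); split.
  by apply: (@spd_diag _ _ _ P e) => // i; rewrite mxE sqrtr_gt0.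
rewrite {}/S AE -!mulmxA; congr (_ *m _); rewrite !mulmxA; congr (_ *m _).
rewrite -(mulmxA _ P^T) PP mulmx1 mul_diag_mx; apply/matrixP => i j.
rewrite !mxE; case: eqVneq => [->|]; rewrite ?mulr0n ?mulr0// !mulr1n.
by rewrite -expr2 sqr_sqrtr// ltW.
Qed.

Lemma spd_sqrt_eq (R : realType) (n : nat) (A S : 'M[R]_n) :
  spd S -> S *m S = A -> spd_sqrt A = S.
Proof.
move=> S0 SA.
rewrite /spd_sqrt; case: xgetP => [T _ [T0 TA]|noS]; last by case: (noS S).
by apply: spd_sqrt_unique => //; rewrite TA.
Qed.

(** * Derivatives of matrix-valued maps *)

Lemma is_derive_mxP (R : realType) (V : normedModType R) (m n : nat)
    (M : V -> 'M[R]_(m, n)) (t v : V) (dM : 'M[R]_(m, n)) :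
  is_derive t v M dM <-> forall i j, is_derive t v (fun x => M x i j) (dM i j).
Proof.
split=> [[/[dup] Md /derivable_mxP Mij <-] i j|Mij].
  by rewrite derive_mx// mxE; apply: DeriveDef.
have Md : derivable M t v by apply/derivable_mxP => i j; have [] := Mij i j.
apply: DeriveDef => //; rewrite derive_mx//; apply/matrixP => i j; rewrite mxE.
by have [] := Mij i j.
Qed.

Lemma is_derive_bigsum (R : realType) (V : normedModType R) (I : Type)
    (r : seq I) (P : pred I) (F : I -> V -> R) (dF : I -> R) (t v : V) :
  (forall i, is_derive t v (F i) (dF i)) ->
  is_derive t v (fun x => \sum_(i <- r | P i) F i x) (\sum_(i <- r | P i) dF i).
Proof.
move=> dFi; elim: r => [|i r IH].
  rewrite big_nil; under eq_fun do rewrite big_nil.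
  exact: is_derive_cst.
rewrite big_cons; under eq_fun do rewrite big_cons.
by case: ifP => _; [exact: is_deriveD|exact: IH].
Qed.

Lemma derivable_bigprod (R : realType) (V : normedModType R) (I : Type)
    (r : seq I) (P : pred I) (F : I -> V -> R) (t v : V) :
  (forall i, derivable (F i) t v) ->
  derivable (fun x => \prod_(i <- r | P i) F i x) t v.
Proof.
move=> dFi; elim: r => [|i r IH].
  by under eq_fun do rewrite big_nil; exact: derivable_cst.
under eq_fun do rewrite big_cons.
by case: ifP => // _; apply: derivableM.
Qed.

Lemma is_derive_mul (R : realType) (V : normedModType R) (f g : V -> R)
    (t v : V) (df dg : R) :
  is_derive t v f df -> is_derive t v g dg ->
  is_derive t v (fun x => f x * g x) (df * g t + f t * dg).
Proof. by move=> fd gd; rewrite addrC [df * _]mulrC; exact: is_deriveM. Qed.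

Lemma is_derive_mulmx (R : realType) (V : normedModType R) (m n p : nat)
    (A : V -> 'M[R]_(m, n)) (B : V -> 'M[R]_(n, p)) t v dA dB :
  is_derive t v A dA -> is_derive t v B dB ->
  is_derive t v (fun x => A x *m B x) (dA *m B t + A t *m dB).
Proof.
move=> /is_derive_mxP Ad /is_derive_mxP Bd; apply/is_derive_mxP => i j.
rewrite mxE [in X in X + _]mxE mxE -big_split/=.
under eq_fun do rewrite mxE.
apply: is_derive_bigsum => k.
exact: is_derive_mul.
Qed.

(** Expanding the argument on the matrix units turns each entry of [f (M x)] into a finite sum of
    entries of [M x] with constant coefficients. *)
Lemma is_derive_linear (R : realType) (V : normedModType R) (m n p q : nat)
    (f : {linear 'M[R]_(m, n) -> 'M[R]_(p, q)}) (M : V -> 'M[R]_(m, n)) t v dM :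
  is_derive t v M dM -> is_derive t v (fun x => f (M x)) (f dM).
Proof.
move=> /is_derive_mxP Md; apply/is_derive_mxP => i j.
have fE (X : 'M[R]_(m, n)) :
    f X i j = \sum_k \sum_l X k l * f (delta_mx k l) i j.
  rewrite {1}[X]matrix_sum_delta !linear_sum summxE; apply: eq_bigr => k _.
  by rewrite linear_sum summxE; apply: eq_bigr => l _; rewrite linearZ mxE.
rewrite fE; under eq_fun do rewrite fE.
apply: is_derive_bigsum => k; apply: is_derive_bigsum => l.
rewrite -[X in is_derive _ _ _ X]addr0 -[X in _ + X](mulr0 (M t k l)).
exact: is_derive_mul.
Qed.

Lemma derivable_det (R : realType) (V : normedModType R) (n : nat)
    (A : V -> 'M[R]_n) t v :
  derivable A t v -> derivable (fun x => \det (A x)) t v.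
Proof.
move=> /derivable_mxP Ad.
have F (s : 'S_n) : derivable (fun x => (-1) ^+ s * \prod_i A x i (s i)) t v.
  by apply: derivableM; [exact: derivable_cst|exact: derivable_bigprod].
by have [] := is_derive_bigsum (index_enum _) xpredT (fun s => derivableP (F s)).
Qed.

Lemma derivable_invmx (R : realType) (n : nat) (A : R -> 'M[R]_n) (t : R) :
  derivable A t 1 -> A t \in unitmx -> derivable (fun x => invmx (A x)) t 1.
Proof.
move=> Ad Au.
have dd := derivable_det Ad.
have d0 : \det (A t) != 0 by rewrite -unitfE -unitmxE.
(* Cramer's formula agrees with [invmx] only where the determinant is nonzero, which by continuity
   holds near [t]. *)
apply: (@near_eq_derivable _ _ _ (fun x => (\det (A x))^-1 *: \adj (A x))).
  have : \forall x \near t, \det (A x) != 0.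
    move/derivable1_diffP/differentiable_continuous : dd => /cvgr_neq0.
    by apply.
  by apply: filterS => x Ax0; rewrite /invmx unitmxE unitfE Ax0.
apply/derivable_mxP => i j.
under eq_fun do rewrite 2!mxE /cofactor.
apply: derivableM; first exact: derivableV.
apply: derivableM; first exact: derivable_cst.
apply: derivable_det; apply/derivable_mxP => k l.
under eq_fun do rewrite !mxE.
by move/derivable_mxP : Ad; apply.
Qed.

(** * The Lyapunov equation *)

(** The operator sending [Y] to [T Y + Y T], as a matrix acting on vectorized rows, so that its
    inverse and the derivative of this inverse come from [invmx]. *)
Definition sylvester_mx (R : comNzRingType) (n : nat) (T : 'M[R]_n) :
    'M[R]_(n * n) := lin_mulmx T + lin_mulmxr T.

(** The operator L_T; it solves the equation whenever [sylvester_mx T] is invertible. *)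
Definition lyapunov (R : fieldType) (n : nat) (T X : 'M[R]_n) : 'M[R]_n :=
  vec_mx (mxvec X *m invmx (sylvester_mx T)).

Lemma mul_sylvester_mx (R : comNzRingType) (n : nat) (T Y : 'M[R]_n) :
  mxvec Y *m sylvester_mx T = mxvec (T *m Y + Y *m T).
Proof. by rewrite mulmxDr !mul_vec_lin linearD. Qed.

Lemma sylvester_mx_unit (R : realType) (n : nat) (T : 'M[R]_n) :
  spd T -> sylvester_mx T \in unitmx.
Proof.
move=> T0; rewrite unitmxE unitfE; apply/negP => /det0P[v v0 vT].
move/negP : v0; apply; rewrite -[v]vec_mxK.
suff -> : vec_mx v = 0 by rewrite linear0.
apply: (sylvester2_eq0 T0 T0); apply: (can_inj mxvecK).
by rewrite -mul_sylvester_mx vec_mxK vT linear0.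
Qed.

Section lyapunov.
Variables (R : fieldType) (n : nat) (T : 'M[R]_n).
Hypothesis Tu : sylvester_mx T \in unitmx.

Lemma lyapunovK (X : 'M[R]_n) : T *m lyapunov T X + lyapunov T X *m T = X.
Proof.
apply: (can_inj mxvecK); rewrite -mul_sylvester_mx vec_mxK mulmxKV//.
Qed.

Lemma lyapunov_eq (X Y : 'M[R]_n) : T *m Y + Y *m T = X -> Y = lyapunov T X.
Proof.
by move=> <-; rewrite /lyapunov -mul_sylvester_mx mulmxK// mxvecK.
Qed.

Lemma lyapunov_tr (X : 'M[R]_n) : T^T = T -> X^T = X ->
  (lyapunov T X)^T = lyapunov T X.
Proof.
move=> TT XT; apply: lyapunov_eq; rewrite -[RHS]XT -[in RHS](lyapunovK X).
by rewrite linearD/= !trmx_mul TT addrC.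
Qed.

End lyapunov.

Lemma derivable_sylvester_mx (R : realType) (n : nat) (T : R -> 'M[R]_n) (t : R) :
  derivable T t 1 -> derivable (fun x => sylvester_mx (T x)) t 1.
Proof.
move=> /derivableP Td; apply: derivableD.
  by have [] := is_derive_linear (@lin_mulmx R n n n) Td.
by have [] := is_derive_linear (@lin_mulmxr R n n n) Td.
Qed.

Lemma derivable_lyapunov (R : realType) (n : nat) (T X : R -> 'M[R]_n) (t : R) :
  sylvester_mx (T t) \in unitmx -> derivable T t 1 -> derivable X t 1 ->
  derivable (fun x => lyapunov (T x) (X x)) t 1.
Proof.
move=> Tu Td /derivableP Xd.
have /derivableP Id := derivable_invmx (derivable_sylvester_mx Td) Tu.
by have [] := is_derive_linear vec_mx
  (is_derive_mulmx (is_derive_linear mxvec Xd) Id).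
Qed.

(** * The Bures-Wasserstein metric and its Levi-Civita connection *)

(** In an eigenbasis of [T] the Lyapunov equation reads (d_i + d_j) L'_ij = Y'_ij, so dividing by
    d_i + d_j applies L_T. Invertibility of the Sylvester operator is the form of the hypothesis
    that is directly seen to persist near a point. *)
Lemma bw_metricE (R : realType) (n : nat) (T X Y : 'M[R]_n) :
  T^T = T -> sylvester_mx T \in unitmx ->
  bw_metric T X Y = 2^-1 * \tr (X^T *m lyapunov T Y).
Proof.
move=> TT Tu; rewrite /bw_metric; case: xgetP => [[P d] _ [/= PP TE]|noPd];
  last by have [Pd Pdd] := spectral_theorem TT; case: (noPd Pd).
have PPT := mulmx1C PP.
congr (_ * _); set L := lyapunov T Y.
(* If d_i + d_j vanished, the rotated matrix unit [E] would be a nonzero element of the kernel of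
   the Sylvester operator. *)
have d_neq0 i j : d 0 i + d 0 j != 0.
  apply/eqP => dij0; pose E := P *m delta_mx i j *m P^T.
  have E0 : E = lyapunov T 0.
    apply: lyapunov_eq => //; rewrite TE /E !mulmxA -!(mulmxA _ P^T) PP !mulmx1.
    rewrite -mulmxDl -!(mulmxA P) -mulmxDr.
    suff -> : diag_mx d *m delta_mx i j + delta_mx i j *m diag_mx d = 0.
      by rewrite mulmx0 mul0mx.
    rewrite mul_diag_mx mul_mx_diag; apply/matrixP => k l; rewrite !mxE.
    case: eqVneq => [->|_]; last by rewrite /= mulr0 mul0r addr0.
    case: eqVneq => [->|_]; last by rewrite /= mulr0 mul0r addr0.
    by rewrite mulr1 mul1r.
  have : delta_mx i j = 0 :> 'M[R]_n.
    have <- : P^T *m E *m P = delta_mx i j.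
      by rewrite /E !mulmxA PP mul1mx -mulmxA PP mulmx1.
    by rewrite E0 /lyapunov linear0 mul0mx linear0 mulmx0 mul0mx.
  move/matrixP/(_ i j); rewrite !mxE !eqxx => /eqP.
  by rewrite oner_eq0.
have YE : P^T *m Y *m P = diag_mx d *m (P^T *m L *m P) + P^T *m L *m P *m diag_mx d.
  rewrite -[in LHS](lyapunovK Tu Y) -/L TE mulmxDr mulmxDl.
  rewrite !mulmxA PP mul1mx; congr (_ + _).
  by rewrite -(mulmxA _ P^T P) PP mulmx1.
have -> : \tr (X^T *m L) = \tr ((P^T *m X *m P)^T *m (P^T *m L *m P)).
  rewrite !trmx_mul trmxK -!mulmxA (mulmxA P) PPT mul1mx.
  by rewrite [RHS]mxtrace_mulC -!mulmxA PPT mulmx1.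
have YEij i j : (P^T *m Y *m P) i j = (d 0 i + d 0 j) * (P^T *m L *m P) i j.
  rewrite YE; move: (P^T *m L *m P) => M.
  by rewrite mul_diag_mx mul_mx_diag !mxE; ring.
rewrite exchange_big; apply: eq_bigr => j _; rewrite [in RHS]mxE.
apply: eq_bigr => i _; by rewrite YEij [in RHS]mxE mulrCA mulKf.
Qed.

(** The Sylvester operator is self-adjoint for the trace pairing, hence so is its inverse. *)
Lemma lyapunov_adjoint (R : fieldType) (n : nat) (T X Y : 'M[R]_n) :
  sylvester_mx T \in unitmx ->
  \tr (X *m lyapunov T Y) = \tr (lyapunov T X *m Y).
Proof.
move=> Tu; rewrite -{1}(lyapunovK Tu X) -[in RHS](lyapunovK Tu Y).
rewrite mulmxDl mulmxDr !mxtraceD addrC -!mulmxA; congr (_ + _).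
by rewrite mxtrace_mulC -!mulmxA.
Qed.

(** Reduces a directional derivative to one real variable, where inverses can be differentiated. *)
Lemma is_derive_line (R : realType) (V W : normedModType R) (f : V -> W)
    (x v : V) (df : W) :
  is_derive x v f df -> is_derive (0 : R) (1 : R) (fun h => f (h *: v + x)) df.
Proof.
move=> [fd <-].
have E : (fun h => h^-1 *: ((f \o shift x) (h *: v) - f x)) =
    (fun h : R => h^-1 *: (((fun h => f (h *: v + x)) \o shift 0) (h *: (1 : R))
       - f (0 *: v + x))).
  by apply/funext => h; rewrite /= addr0 scale0r add0r [h *: 1]mulr1.
by split; rewrite /derivable /derive -E.
Qed.

(** Along T = S + h Z, differentiating T L + L T = Y at h = 0 gives S L' + L' S = - (Z L + L Z). The
    derivative of the metric is 1/2 tr(X L'), and self-adjointness moves L_S onto [X]. *)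
Lemma derive_bw_metric (R : realType) (n : nat) (S X Y Z : 'M[R]_n) (v : R) :
  spd S -> X^T = X -> Z^T = Z ->
  is_derive S Z (fun T : 'M[R]_n => bw_metric T X Y) v ->
  v = - (2^-1 * \tr (lyapunov S X *m (Z *m lyapunov S Y + lyapunov S Y *m Z))).
Proof.
move=> S0 XT ZT /is_derive_line vd.
pose T (h : R) : 'M[R]_n := h *: Z + S.
have T0 : T 0 = S by rewrite /T scale0r add0r.
have Tu := sylvester_mx_unit S0.
have Td : is_derive (0 : R) (1 : R) T Z.
  exact: is_derive_line (is_derive_id S Z).
(* Invertibility is an open condition, by continuity of the determinant; it replaces definiteness of
   [T h]. *)
have TTu : \forall h \near (0 : R), sylvester_mx (T h) \in unitmx.
  have [/derivable_sylvester_mx/derivable_det + _] := Td.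
  move=> /derivable1_diffP/differentiable_continuous/cvgr_neq0.
  rewrite T0 -unitfE -unitmxE => /(_ Tu); apply: filterS => h.
  by rewrite unitmxE unitfE.
pose L h := lyapunov (T h) Y.
have Ld : is_derive (0 : R) (1 : R) L ('D_1 L 0).
  apply/derivableP/derivable_lyapunov; first by rewrite T0.
    by have [] := Td.
  exact: derivable_cst.
have dL : S *m 'D_1 L 0 + 'D_1 L 0 *m S = - (Z *m lyapunov S Y + lyapunov S Y *m Z).
  have := is_deriveD (is_derive_mulmx Td Ld) (is_derive_mulmx Ld Td).
  rewrite T0 /L T0 -/L => dTL.
  have : is_derive (0 : R) (1 : R) (cst Y)
      (Z *m lyapunov S Y + S *m 'D_1 L 0 + ('D_1 L 0 *m S + lyapunov S Y *m Z)).
    apply: near_eq_is_derive dTL; apply: filterS TTu => h hu.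
    exact: lyapunovK.
  move=> [_]; rewrite derive_cst => /esym E; apply/eqP; rewrite -addr_eq0 -E.
  by apply/eqP/matrixP => i j; rewrite !mxE; ring.
have : is_derive (0 : R) (1 : R) (fun h => bw_metric (h *: Z + S) X Y)
    (2^-1 * \tr (X *m 'D_1 L 0)).
  apply: (@near_eq_is_derive _ _ _ (fun h => 2^-1 * \tr (X *m L h))).
    apply: filterS TTu => h hu; rewrite bw_metricE ?XT//.
    by rewrite linearD/= linearZ/= ZT (spd_tr S0).
  have /is_derive_mxP XLd := is_derive_linear (mulmx X) Ld.
  have := is_derive_mul (is_derive_cst (2^-1 : R) _ _)
    (is_derive_bigsum (index_enum _) xpredT (fun i => XLd i i)).
  by rewrite mul0r add0r.
move=> [_]; have [_ ->] := vd => ->.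
rewrite -[in LHS](lyapunovK Tu X) mulmxDl mxtraceD -!mulmxA mxtrace_mulC.
by rewrite -mulmxA -mxtraceD -mulmxDr addrC dL mulmxN linearN/= mulrN.
Qed.

(* Koszul's argument: the difference between [Gamma] and the claimed Christoffel
   symbols is symmetric in its arguments and skew for the metric, hence zero. *)
Lemma levi_civita_bw (R : realType) (n : nat)
    (Gamma : 'M[R]_n -> 'M[R]_n -> 'M[R]_n -> 'M[R]_n) (S X Y : 'M[R]_n) :
  levi_civita (@bw_metric R n) Gamma -> spd S -> X^T = X -> Y^T = Y ->
  Gamma S X Y = - (lyapunov S X *m S *m lyapunov S Y
                   + lyapunov S Y *m S *m lyapunov S X).
Proof.
move=> [Gc Gt Gm] S0 XT YT; have Tu := sylvester_mx_unit S0.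
have ST := spd_tr S0.
have Gtr A B : A^T = A -> B^T = B -> (Gamma S A B)^T = Gamma S A B.
  move=> /symmetricmxP As /symmetricmxP Bs.
  by apply/symmetricmxP; have [] := Gc S S0 0 A B B As Bs Bs.
have vf A : A^T = A -> vector_field (cst A : 'M[R]_n -> 'M[R]_n).
  move=> AT T _; split; first exact/symmetricmxP.
  by move=> V _; exact: derivable_cst.
have nablaE A B : nabla Gamma (cst A) (cst B) S = Gamma S A B.
  by rewrite /nabla derive_cst add0r.
have GC A B : A^T = A -> B^T = B -> Gamma S A B = Gamma S B A.
  move=> AT BT; apply/eqP; rewrite -subr_eq0 -!nablaE.
  by rewrite (Gt _ _ (vf _ AT) (vf _ BT))// /lie_bracket !derive_cst subrr.
pose b A B := - (lyapunov S A *m S *m lyapunov S B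
                 + lyapunov S B *m S *m lyapunov S A).
pose D A B := Gamma S A B - b A B.
have Dtr A B : A^T = A -> B^T = B -> (D A B)^T = D A B.
  move=> AT BT; rewrite /D /b linearB/= Gtr// linearN linearD/= !trmx_mul ST.
  by rewrite !(lyapunov_tr Tu)// !mulmxA; congr (_ - (- _)); exact: addrC.
have DC A B : A^T = A -> B^T = B -> D A B = D B A.
  by move=> AT BT; rewrite /D (GC A B)// /b; congr (_ - (- _)); exact: addrC.
(* Up to the factor 1/2, this is metric compatibility of the candidate [b] on constant fields. *)
have bE A B C : A^T = A ->
    \tr (b A B *m lyapunov S C) + \tr (lyapunov S B *m b A C)
    = - \tr (lyapunov S B *m (A *m lyapunov S C + lyapunov S C *m A)).
  move=> AT; rewrite -{3 4}(lyapunovK Tu A) /b.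
  move: (lyapunov S A) (lyapunov S B) (lyapunov S C) => x y z.
  rewrite mulNmx mulmxN !linearN/= -opprD; congr (- _).
  rewrite !mulmxDl !mulmxDr !mxtraceD !mulmxA.
  have -> : \tr (x *m S *m y *m z) = \tr (y *m z *m x *m S).
    by rewrite -mulmxA mxtrace_mulC !mulmxA.
  by ring.
(* For symmetric arguments, twice the metric applied to [D A B] and [C]. *)
pose tau A B C := \tr (D A B *m lyapunov S C).
have tauN A B C : A^T = A -> B^T = B -> C^T = C -> tau A B C = - tau A C B.
  move=> AT BT CT.
  have := derive_bw_metric S0 BT AT (Gm _ _ _ (vf _ BT) (vf _ CT) (vf _ AT) S S0).
  rewrite !nablaE !bw_metricE// BT Gtr// (lyapunov_adjoint B _ Tu) -mulrDr -mulrN.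
  have h2 : 2^-1 != 0 :> R by rewrite invr_eq0 pnatr_eq0.
  move=> /(mulfI h2); rewrite -(bE _ B C AT) => H.
  rewrite /tau /D !mulmxBl !linearB/= -[\tr (Gamma S A C *m _)]mxtrace_mulC.
  rewrite -[\tr (b A C *m _)]mxtrace_mulC.
  by move: H; rewrite /cst; lra.
have tauC A B C : A^T = A -> B^T = B -> tau A B C = tau B A C.
  by move=> AT BT; rewrite /tau DC.
(* Three skew swaps of the last two arguments, alternating with three symmetric swaps of the first
   two, restore the order and leave a minus sign. *)
have tau0 A B C : A^T = A -> B^T = B -> C^T = C -> tau A B C = 0.
  move=> AT BT CT; have : tau A B C = - tau A B C.
    rewrite {1}(tauN A B C AT BT CT) (tauC A C B AT CT) (tauN C A B CT AT BT).
    by rewrite opprK (tauC C B A CT BT) (tauN B C A BT CT AT) (tauC B A C BT AT).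
  by move/eqP; rewrite -addr_eq0 -mulr2n mulrn_eq0 => /eqP.
have DT := Dtr X Y XT YT.
have LT := lyapunov_tr Tu ST DT.
suff L0 : lyapunov S (D X Y) = 0.
  apply/eqP; rewrite -subr_eq0 -[_ - _]/(D X Y) -(lyapunovK Tu (D X Y)) L0.
  by rewrite mulmx0 mul0mx addr0.
apply: (spd_trace_eq0 S0); rewrite LT.
(* With [D X Y] as third argument and L its image under L_S, [tau] is twice the trace of L S L,
   where definiteness of [S] applies. *)
have := tau0 X Y _ XT YT DT; rewrite /tau.
rewrite -{1}(lyapunovK Tu (D X Y)) mulmxDl mxtraceD -mulmxA mxtrace_mulC.
by move/eqP; rewrite -mulr2n mulrn_eq0 => /eqP.
Qed.

(** * Calculus along curves of matrices *)

(** Unlike [mxE], this rule and the next leave products folded, so that [ring] takes their entries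
    as atoms. *)
Lemma addmxE (R : nmodType) (m n : nat) (A B : 'M[R]_(m, n)) i j :
  (A + B) i j = A i j + B i j.
Proof. by rewrite mxE. Qed.

Lemma oppmxE (R : zmodType) (m n : nat) (A : 'M[R]_(m, n)) i j :
  (- A) i j = - A i j.
Proof. by rewrite mxE. Qed.

Lemma is_derive_derive1 (R : realType) (W : normedModType R) (f : R -> W) (t : R) :
  derivable f t 1 -> is_derive t 1 f (derive1 f t).
Proof. by rewrite derive1E => /derivableP. Qed.

Lemma is_derive_scalemx (R : realType) (m n : nat) (a : R -> R)
    (A : R -> 'M[R]_(m, n)) (t da : R) dA :
  is_derive t 1 a da -> is_derive t 1 A dA ->
  is_derive t 1 (fun x => a x *: A x) (da *: A t + a t *: dA).
Proof.
move=> ad /is_derive_mxP Ad; apply/is_derive_mxP => i j.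
rewrite !mxE; under eq_fun do rewrite mxE.
exact: is_derive_mul.
Qed.

(** The mean value theorem, entry by entry; it is how first integrals are exploited. *)
Lemma is_derive0_cst (R : realType) (m n : nat) (J : set R)
    (A : R -> 'M[R]_(m, n)) (a b : R) :
  is_interval J -> (forall t, J t -> is_derive t 1 A 0) -> J a -> J b ->
  A a = A b.
Proof.
move=> Ji A0; wlog ab : a b / a <= b => [H|Ja Jb].
  have [ab|/ltW ba] := leP a b; first exact: H.
  by move=> Ja Jb; apply/esym/H.
apply/matrixP => i j.
have Aij t : J t -> is_derive t 1 (fun x => A x i j) 0.
  by move=> /A0/is_derive_mxP/(_ i j); rewrite mxE.
have Jab t : t \in `[a, b] -> J t.
  by rewrite in_itv/= => tab; apply: (Ji a b).
have [||c _] := @MVT_segment R (fun x => A x i j) (cst 0) a b ab.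
- by move=> t tab; apply/Aij/Jab/subset_itv_oo_cc.
- apply: derivable_within_continuous => t tab.
  by have [] := Aij t (Jab t tab).
by rewrite /cst mul0r => /eqP; rewrite subr_eq0 => /eqP.
Qed.

(** * From the geodesic equation to a Riccati equation *)

Section geodesic.
Variables (R : realType) (n : nat).
Variable Gamma : 'M[R]_n -> 'M[R]_n -> 'M[R]_n -> 'M[R]_n.
Variable J : set R.
Variable gamma : R -> 'M[R]_n.
Hypothesis gamma_geo : geodesic Gamma J gamma.

Lemma geodesic_spd t : J t -> spd (gamma t).
Proof. by move=> Jt; have [/(_ t Jt)[]] := gamma_geo. Qed.

Lemma velocity_tr t : J t -> (derive1 gamma t)^T = derive1 gamma t.
Proof. by move=> Jt; have [_ [/(_ t Jt)/symmetricmxP]] := gamma_geo. Qed.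

Lemma geodesic_lyapunov_tr t : J t ->
  (lyapunov (gamma t) (derive1 gamma t))^T = lyapunov (gamma t) (derive1 gamma t).
Proof.
move=> Jt; have gt := geodesic_spd Jt.
exact: (lyapunov_tr (sylvester_mx_unit gt) (spd_tr gt) (velocity_tr Jt)).
Qed.

Lemma is_derive_geodesic t (Y := lyapunov (gamma t) (derive1 gamma t)) : J t ->
  is_derive t 1 gamma (gamma t *m Y + Y *m gamma t).
Proof.
move=> Jt; rewrite /Y (lyapunovK (sylvester_mx_unit (geodesic_spd Jt))).
by apply: is_derive_derive1; have [/(_ t Jt)[]] := gamma_geo.
Qed.

(** Differentiating gamma' = gamma Y + Y gamma produces 2 Y gamma Y, which the Christoffel term
    cancels. What remains is the homogeneous Lyapunov equation for Y' + Y^2. *)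
Lemma geodesic_riccati t (Y := fun t => lyapunov (gamma t) (derive1 gamma t)) :
  levi_civita (@bw_metric R n) Gamma -> open J -> J t ->
  is_derive t 1 Y (- (Y t *m Y t)).
Proof.
move=> hGamma Jopen Jt; have gt := geodesic_spd Jt.
have [gd [_ /(_ t Jt)[dd cov]]] := gamma_geo.
have Yd : is_derive t 1 Y (derive1 Y t).
  apply: is_derive_derive1.
  exact: (derivable_lyapunov (sylvester_mx_unit gt) (gd t Jt).2 dd).
have gamd := is_derive_geodesic Jt.
have E1 := is_deriveD (is_derive_mulmx gamd Yd) (is_derive_mulmx Yd gamd).
have vE : \forall x \near t, gamma x *m Y x + Y x *m gamma x = derive1 gamma x.
  apply: filterS (open_nbhs_nbhs (conj Jopen Jt)) => x Jx.
   exact: (lyapunovK (sylvester_mx_unit (geodesic_spd Jx))).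
have {}E1 := near_eq_is_derive vE E1.
have vt := velocity_tr Jt.
move: cov; rewrite /cov_derive (levi_civita_bw hGamma gt vt vt).
rewrite derive1E; have [_ ->] := E1.
rewrite -[lyapunov _ _]/(Y t); move: Yd; move: (derive1 Y t) => dY Yd cov.
suff <- : dY = - (Y t *m Y t) by [].
apply/eqP; rewrite -addr_eq0; apply/eqP; apply: (sylvester2_eq0 gt gt).
rewrite -[RHS]cov; move: (gamma t) (Y t) => g y.
rewrite !mulmxDl !mulmxDr !mulmxA.
by apply/matrixP => i j; rewrite !(addmxE, oppmxE); ring.
Qed.

End geodesic.

(** * Explicit solution of the Riccati system *)

Section riccati.
Variables (R : realType) (n : nat) (J : set R) (gamma Y : R -> 'M[R]_n).
Hypotheses (Jint : is_interval J) (J0 : J 0).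
Hypothesis gamma_spd : forall t, J t -> spd (gamma t).
Hypothesis Y_tr : forall t, J t -> (Y t)^T = Y t.
Hypothesis is_derive_gamma : forall t, J t ->
  is_derive t 1 gamma (gamma t *m Y t + Y t *m gamma t).
Hypothesis riccati : forall t, J t -> is_derive t 1 Y (- (Y t *m Y t)).

Let S := Y 0.
Let M t : 'M[R]_n := 1%:M + t *: S.

Lemma is_derive_affine (t : R) : is_derive t 1 M S.
Proof.
have := is_deriveD (is_derive_cst (1%:M : 'M[R]_n) t 1)
  (is_derive_scalemx (is_derive_id t 1) (is_derive_cst S t 1)).
by rewrite add0r scale1r scaler0 addr0.
Qed.

Lemma affine_tr (t : R) : (M t)^T = M t.
Proof. by rewrite /M linearD/= trmx1 linearZ/= Y_tr. Qed.

(* [W = S - Y (1 + t S)] solves [W' = - Y W], and [W^T gamma W] is a first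
   integral of this equation, so that [W] vanishes because [gamma] is definite. *)
Lemma riccati_mulM t : J t -> Y t *m M t = S.
Proof.
move=> Jt; pose W x := S - Y x *m M x.
have Wd x : J x -> is_derive x 1 W (- (Y x *m W x)).
  move=> Jx; have := is_deriveB (is_derive_cst S x 1)
    (is_derive_mulmx (riccati Jx) (is_derive_affine x)).
  rewrite sub0r; congr is_derive.
  by rewrite /W mulNmx mulmxBr mulmxA opprD opprB opprK addrC.
pose Q x := (W x)^T *m (gamma x *m W x).
have Qd x : J x -> is_derive x 1 Q 0.
  move=> Jx; have := is_derive_mulmx (is_derive_linear trmx (Wd x Jx))
    (is_derive_mulmx (is_derive_gamma Jx) (Wd x Jx)).
  congr is_derive; rewrite linearN/= trmx_mul Y_tr//.
  move: (W x) => w; rewrite mulmxDl mulmxDr mulNmx !mulmxN !mulmxA.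
  rewrite !mulmxDr !mulmxA.
  by apply/matrixP => i j; rewrite !(addmxE, oppmxE) [RHS]mxE; ring.
have W0 : W 0 = 0 by rewrite /W /M scale0r addr0 mulmx1 subrr.
have Qt : Q t = 0 by rewrite (is_derive0_cst Jint Qd Jt J0) /Q W0 !mulmx0.
apply/esym/eqP; rewrite -subr_eq0; apply/eqP.
apply: (@spd_trace_eq0 _ _ _ (gamma t) (W t) (gamma_spd Jt)).
by rewrite -[X in \tr X]mulmxA -/(Q t) Qt mxtrace0.
Qed.

(** The inverse of [M t] on [J]: as Y M = S, the product (1 - t Y) M is M - t S = 1. *)
Let N t : 'M[R]_n := 1%:M - t *: Y t.

Lemma riccati_mulVM t : J t -> N t *m M t = 1%:M.
Proof.
move=> Jt; rewrite mulmxBl mul1mx -scalemxAl riccati_mulM//.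
by rewrite /M addrK.
Qed.

Lemma riccati_unitmx t : J t -> M t \in unitmx.
Proof. by move=> /riccati_mulVM/mulmx1_unit[]. Qed.

(** Since N' = - N Y and N commutes with Y, the product N gamma N is constant, equal to [gamma 0];
    inverting N on both sides gives the formula. *)
Lemma riccati_gammaE t : J t -> gamma t = M t *m gamma 0 *m M t.
Proof.
move=> Jt.
have Nd x : J x -> is_derive x 1 N (- (N x *m Y x)).
  move=> Jx; have := is_deriveB (is_derive_cst (1%:M : 'M[R]_n) x 1)
    (is_derive_scalemx (is_derive_id x 1) (riccati Jx)).
  rewrite sub0r; congr is_derive.
  by rewrite /N mulmxBl mul1mx -scalemxAl scale1r scalerN.
have NY x : N x *m Y x = Y x *m N x.
  by rewrite /N mulmxBl mulmxBr mul1mx mulmx1 -scalemxAl -scalemxAr.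
pose Q x := N x *m (gamma x *m N x).
have Qd x : J x -> is_derive x 1 Q 0.
  move=> Jx; have := Nd x Jx; rewrite NY => Nd'.
  have := is_derive_mulmx (Nd x Jx) (is_derive_mulmx (is_derive_gamma Jx) Nd').
  congr is_derive; move: (N x) => w; rewrite mulmxDl mulNmx !(mulmxN, mulmxDr) !mulmxA.
  by apply/matrixP => i j; rewrite !(addmxE, oppmxE) [RHS]mxE; ring.
have Q0 : gamma 0 = N t *m gamma t *m N t.
  rewrite -mulmxA -/(Q t) (is_derive0_cst Jint Qd Jt J0).
  by rewrite /Q /N scale0r subr0 mulmx1 mul1mx.
have NM := riccati_mulVM Jt; have MN := mulmx1C NM.
by rewrite Q0 !mulmxA MN mul1mx -mulmxA NM mulmx1.
Qed.

(** The right side is what the product of the horizontal lift and its transposed derivative expands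
    to. *)
Lemma gamma_mulY t : J t -> gamma t *m Y t = M t *m gamma 0 *m S.
Proof.
move=> Jt; rewrite riccati_gammaE// -mulmxA; congr (_ *m _).
rewrite -[S](Y_tr J0) -[X in X^T](riccati_mulM Jt).
by rewrite trmx_mul affine_tr Y_tr.
Qed.

(** The eigenvalues of [M t] are 1 + t d_i. One that is nonpositive at t = 1 must vanish at t = - 1
    / d_i, a time in [0, 1], against invertibility of [M t] on [J]. *)
Lemma riccati_M1_spd : J 1 -> spd (M 1).
Proof.
move=> J1.
have [[P d] [/= PP SE]] := spectral_theorem (Y_tr J0).
have PPT := mulmx1C PP.
have ME t : M t = P *m diag_mx (const_mx 1 + t *: d) *m P^T.
  rewrite linearD/= linearZ/= diag_const_mx mulmxDr mulmxDl mulmx1 PPT.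
  by rewrite -scalemxAr -scalemxAl -SE.
apply: (@spd_diag _ _ _ P (const_mx 1 + 1 *: d)).
  by split => //=; rewrite -ME.
move=> i; rewrite !mxE mul1r ltNge; apply/negP => di.
have di0 : d 0 i < 0 by lra.
have Jt : J (- (d 0 i)^-1).
  apply: (Jint J0 J1); rewrite oppr_ge0 invr_le0 ltW//=.
  by rewrite -invrN invf_le1 ?oppr_gt0//; lra.
have := riccati_unitmx Jt; rewrite ME !unitmx_mul => /andP[/andP[_ + _]].
rewrite unitmxE det_diag unitfE => /prodf_neq0/(_ i isT); rewrite !mxE.
by rewrite mulNr mulVf ?subrr ?eqxx// lt_eqF.
Qed.

(** With A the root of [gamma 0], the positive definite matrix A (M 1) A squares to A (gamma 1) A,
    so it is the root in the lift. The lift thus interpolates affinely between A and (M 1) A. *)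
Lemma bw_horizontal_liftE t : J 1 ->
  bw_horizontal_lift (gamma 0) (gamma 1) t = M t *m spd_sqrt (gamma 0).
Proof.
move=> J1; rewrite /bw_horizontal_lift.
have [A0 AA] := spd_sqrtP (gamma_spd J0).
set A := spd_sqrt (gamma 0) in A0 AA *.
have Au := spd_unitmx A0.
have -> : spd_sqrt (A *m gamma 1 *m A) = A *m (M 1 *m A).
  apply: spd_sqrt_eq.
    by rewrite -{1}(spd_tr A0) mulmxA; apply: spd_congr => //; exact: riccati_M1_spd.
  by rewrite (riccati_gammaE J1) -AA !mulmxA.
rewrite mulKmx// /M !mulmxDl !mul1mx scale1r scalerDr addrA -scalemxAl.
by rewrite scalerBl scale1r subrK.
Qed.

End riccati.

(** * Equivalence of parallel transport with the differential equation *)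

Theorem proposition3p2 (R : realType) (n : nat)
    (Gamma : 'M[R]_n -> 'M[R]_n -> 'M[R]_n -> 'M[R]_n)
    (hGamma : levi_civita (@bw_metric R n) Gamma)
    (Sigma Lambda : 'M[R]_n) (hSigma : spd Sigma) (hLambda : spd Lambda)
    (J : set R) (hJopen : open J) (hJint : is_interval J) (hJ0 : J 0) (hJ1 : J 1)
    (gamma : R -> 'M[R]_n) (hgamma : geodesic Gamma J gamma)
    (hgamma0 : gamma 0 = Sigma) (hgamma1 : gamma 1 = Lambda)
    (X0 : 'M[R]_n) (hX0 : X0 \is symmetricmx)
    (X : R -> 'M[R]_n) (hX : field_along J X) (hXX0 : X 0 = X0) :
  let gammah := bw_horizontal_lift Sigma Lambda in
  parallel_transport Gamma J gamma X0 X <->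
  exists Y : R -> 'M[R]_n, forall t : R, J t ->
    [/\ Y t \is symmetricmx,
        derivable Y t 1,
        X t = gamma t *m Y t + Y t *m gamma t
      & gamma t *m derive1 Y t + derive1 Y t *m gamma t
        + gammah t *m (derive1 gammah t)^T *m Y t
        + Y t *m derive1 gammah t *m (gammah t)^T = 0].
Proof.
move=> gammah; pose Z t := lyapunov (gamma t) (derive1 gamma t).
have [A0 AA] := spd_sqrtP hSigma.
have ZT t (Jt : J t) : (Z t)^T = Z t := geodesic_lyapunov_tr hgamma Jt.
have gspd := geodesic_spd hgamma.
have gd := is_derive_geodesic hgamma.
have Zd t (Jt : J t) : is_derive t 1 Z (- (Z t *m Z t)).
  exact: (geodesic_riccati hgamma hGamma hJopen Jt).
have hE : gammah = fun t => (1%:M + t *: Z 0) *m spd_sqrt Sigma.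
  apply/funext => t; rewrite /gammah -hgamma0 -hgamma1.
  exact: (bw_horizontal_liftE hJint hJ0 gspd ZT gd Zd t hJ1).
have hd t : derive1 gammah t = Z 0 *m spd_sqrt Sigma.
  have Md := is_derive_affine Z t.
  have := is_derive_mulmx Md (is_derive_cst (spd_sqrt Sigma) t 1).
  by rewrite mulmx0 addr0 derive1E hE => -[].
have hl t : J t -> gammah t *m (derive1 gammah t)^T = gamma t *m Z t.
  move=> Jt; rewrite (gamma_mulY hJint hJ0 gspd ZT gd Zd Jt).
  rewrite hd hE trmx_mul ZT// (spd_tr A0) -[_ *m (_ *m Z 0)]mulmxA.
  by rewrite (mulmxA (spd_sqrt Sigma)) AA hgamma0 mulmxA.
have hr t : J t -> derive1 gammah t *m (gammah t)^T = Z t *m gamma t.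
  move=> Jt; rewrite -[LHS]trmxK trmx_mul trmxK hl// trmx_mul ZT//.
  by rewrite (spd_tr (gspd t Jt)).
(* Both directions rest on this identity: in the derivative of gamma Y + Y gamma the cross terms Z
   gamma Y and Y gamma Z cancel against the Christoffel term, leaving the left side of the ODE. *)
have covE Y t : J t -> (Y t)^T = Y t -> derivable Y t 1 ->
    (\forall x \near t, X x = gamma x *m Y x + Y x *m gamma x) ->
    derivable X t 1 /\ cov_derive Gamma gamma X t =
      gamma t *m derive1 Y t + derive1 Y t *m gamma t
        + gammah t *m (derive1 gammah t)^T *m Y t
        + Y t *m derive1 gammah t *m (gammah t)^T.
  move=> Jt YT /is_derive_derive1 Yd XE.
  have gdt := gd t Jt.
  have EX : \forall x \near t, gamma x *m Y x + Y x *m gamma x = X x.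
    by apply: filterS XE => x ->.
  have Xd := near_eq_is_derive EX
    (is_deriveD (is_derive_mulmx gdt Yd) (is_derive_mulmx Yd gdt)).
  split; first by have [] := Xd.
  have gS := gspd t Jt.
  have Xt : X t = gamma t *m Y t + Y t *m gamma t := nbhs_singleton XE.
  rewrite /cov_derive (levi_civita_bw hGamma gS (velocity_tr hgamma Jt)); last first.
    exact/symmetricmxP/hX.
  rewrite -(lyapunov_eq (sylvester_mx_unit gS) (esym Xt)) -/(Z t).
  rewrite derive1E; have [_ ->] := Xd.
  rewrite hl// -(mulmxA (Y t)) hr// -/(Z t) !mulmxDl !mulmxDr !mulmxA.
  by apply/matrixP => i j; rewrite !(addmxE, oppmxE); ring.
split.
(* Uniqueness for the Lyapunov equation forces this choice of [Y]. *)
- move=> [_ [_ Xp]]; pose Y t := lyapunov (gamma t) (X t).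
  have gu t (Jt : J t) := sylvester_mx_unit (gspd t Jt).
  exists Y => t Jt; have [Xd Xc] := Xp t Jt.
  have YT : (Y t)^T = Y t.
    apply: lyapunov_tr; [exact: gu| |exact/symmetricmxP/hX].
    exact/spd_tr/gspd.
  have Yd : derivable Y t 1.
    apply: (derivable_lyapunov (gu t Jt) _ Xd).
    by have [] := gd t Jt.
  have YE x : J x -> X x = gamma x *m Y x + Y x *m gamma x.
    by move=> Jx; rewrite lyapunovK// gu.
  split=> //; [exact/symmetricmxP|exact: YE|].
  rewrite -[RHS]Xc; have [|_ -> //] := covE Y t Jt YT Yd.
  by apply: filterS (open_nbhs_nbhs (conj hJopen Jt)) => x; exact: YE.
- move=> [Y HY]; split=> //; split=> // t Jt.
  have [/symmetricmxP YT Yd _ ode] := HY t Jt.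
  have [|Xd ->//] := covE Y t Jt YT Yd.
  (* Openness of [J] turns the pointwise factorization of [X] into one near [t], which can be
     differentiated. *)
  by apply: filterS (open_nbhs_nbhs (conj hJopen Jt)) => x Jx; have [] := HY x Jx.
Qed.
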